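(* Let $F$ be a field, let $D$ be a central division $F$-algebra of degree $d$, and let $n$ be a positive integer. Let $A \in M_n(D)$ and $\lambda \in D$. Then $\lambda$ is a right eigenvalue of $A$ if and only if $\Phi_A(\lambda)=0$, where $\Phi_A(z)\in F[z]$ is the characteristic polynomial of $A$.
   Context: A central division algebra $D$ over $F$ is a division algebra with center $F$ and of finite dimension over $F$; its degree is $d=\sqrt{[D:F]}$. $D^n$ denotes the column vectors of length $n$ over $D$, which is a left $M_n(D)$-module and a $D$-bimodule. A right eigenvalue of $A\in M_n(D)$ is an element $\lambda\in D$ for which there is a nonzero vector $v\in D^n$ with $Av=v\lambda$. Characteristic polynomial: let $K$ be a maximal subfield of $D$. Then $D$ is a right $K$-vector space of dimension $d$, so $D^n$ is a right $K$-vector space of dimension $nd$; fix a $K$-linear isomorphism $g:D^n\to K^{nd}$ (so $g(v\mu)=g(v)\mu$ for $v\in D^n$, $\mu\in K$). Left multiplication by $A \in M_n(D)$ is right $K$-linear on $D^n$, so there is a unique matrix $f(A)\in M_{nd}(K)$ with $g(Av)=f(A)g(v)$ for all $v\in D^n$. The characteristic polynomial of $A$ is $\Phi_A(z)=\det(f(A)-zI)$, with $I$ the identity of $M_{nd}(K)$. It is a known fact that its coefficients lie in $F$ and that it is independent of the choice of the maximal subfield $K$ and of the isomorphism $g$. Since its coefficients lie in the center $F$, it can be evaluated at any element of $D$. *)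

(* Defs.v *)
From HB Require Import structures.
From mathcomp Require Import all_boot all_order all_algebra all_field.

Set Implicit Arguments.
Unset Strict Implicit.
Unset Printing Implicit Defensive.

Import GRing.Theory.
Local Open Scope ring_scope.

(* Finite dimensionality over F is part of falgType. *)
Definition central_division_algebra (F : fieldType) (D : falgType F)
    (d : nat) : Prop :=
  [/\ forall x : D, x != 0 -> x \is a GRing.unit,
      ('Z({:D}) = 1)%VS
    & \dim {:D} = (d ^ 2)%N].

(* Scalars act on the right of a column: the entries of v *m l%:M are
   v i 0 * l. *)
Definition right_eigenvalue (R : nzRingType) (n : nat) (A : 'M[R]_n)
    (lambda : R) : Prop :=
  exists2 v : 'cV[R]_n, v != 0 & A *m v = v *m lambda%:M.

(* In a division ring, the subsets that are fields for the induced operations;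
   they are not required to contain the base field. *)
Definition subfield_pred (D : unitRingType) (S : {pred D}) : Prop :=
  divring_closed S /\ {in S &, commutative *%R}.

(* A subfield of D is given by an abstract field K and an embedding iota (which
   is injective, K being a field); iota(K) is maximal for inclusion. *)
Definition maximal_subfield (D : unitRingType) (K : fieldType)
    (iota : {rmorphism K -> D}) : Prop :=
  forall T : {pred D}, subfield_pred T -> (forall k, iota k \in T) ->
  forall x, x \in T -> exists k, iota k = x.

Definition right_linear_iso (D : nzRingType) (K : fieldType)
    (iota : {rmorphism K -> D}) (n N : nat)
    (g : 'cV[D]_n -> 'cV[K]_N) : Prop :=
  [/\ bijective g,
      {morph g : u v / u + v}
    & forall (v : 'cV[D]_n) (mu : K), g (v *m (iota mu)%:M) = g v *m mu%:M].

Definition represents (D : nzRingType) (K : fieldType) (n N : nat)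
    (g : 'cV[D]_n -> 'cV[K]_N) (A : 'M[D]_n) (fA : 'M[K]_N) : Prop :=
  forall v : 'cV[D]_n, g (A *m v) = fA *m g v.

Lemma represents_exists_unique (D : nzRingType) (K : fieldType)
    (iota : {rmorphism K -> D}) (n N : nat) (g : 'cV[D]_n -> 'cV[K]_N)
    (A : 'M[D]_n) :
  right_linear_iso iota g -> exists! fA : 'M[K]_N, represents g A fA.
Proof.
move=> [[h gK hK] gD gZ].
have g0 : g 0 = 0 by apply: (addrI (g 0)); rewrite -gD !addr0.
have hD : {morph h : u v / u + v}.
  by move=> u v; apply: (can_inj gK); rewrite gD !hK.
have h0 : h 0 = 0 by rewrite -g0 gK.
have hZ v mu : h (v *m mu%:M) = h v *m (iota mu)%:M.
  by apply: (can_inj gK); rewrite gZ !hK.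
pose fA : 'M[K]_N := \matrix_(i, j) g (A *m h (delta_mx j 0)) i 0.
have fAP : represents g A fA.
  move=> v; rewrite -{1}[v]gK; move: (g v) => w.
  have -> : w = \sum_j delta_mx j 0 *m (w j 0)%:M.
    apply/matrixP=> i k; rewrite summxE (bigD1 i) //= big1 ?addr0.
      by rewrite mul_mx_scalar !mxE !eqxx ord1 mulr1.
    by move=> j ji; rewrite mul_mx_scalar !mxE eq_sym (negPf ji) mulr0.
  rewrite (big_morph h hD h0) [A *m _]mulmx_sumr (big_morph g gD g0).
  rewrite [RHS]mulmx_sumr.
  apply: eq_bigr => j _; rewrite hZ mulmxA gZ mulmxA; congr (_ *m _).
  by rewrite -colE; apply/matrixP=> i k; rewrite !mxE ord1.
exists fA; split=> // B BP; apply/matrixP=> i j.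
have := fAP (h (delta_mx j 0)); rewrite BP hK -!colE => /matrixP/(_ i 0).
by rewrite !mxE.
Qed.

(* The convention is det(M - z I), not the det(z I - M) of char_poly. *)
Definition characteristic_poly (K : fieldType) (N : nat) (M : 'M[K]_N) :
    {poly K} :=
  \det (map_mx polyC M - 'X%:M).

(* The value at lambda in D of a polynomial over K, its coefficients being read
   in D through iota. A characteristic polynomial has its coefficients in the
   center, so the side on which they multiply the powers of lambda is
   irrelevant; horner puts them on the left. *)
Definition eval_in (D : nzRingType) (K : fieldType)
    (iota : {rmorphism K -> D}) (p : {poly K}) (lambda : D) : D :=
  (map_poly iota p).[lambda].

(* Main.v *)
(* Write F(A) for the matrix over K of left multiplication by A, and p for its
   characteristic polynomial.

   The coefficients of p lie in F.  If F is finite, then D = F by Wedderburn's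
   little theorem.  If F is infinite, M_n(D) (x)_F K = M_nd(K) and density give
   some B in M_n(D) such that F(B) has a cyclic vector, and then so does
   F(A + t(B - A)) for all but finitely many t in F.  When F(A) has a cyclic
   vector, I, F(A), .., F(A)^(nd-1) are independent over K, so the relation
   given by Cayley-Hamilton is proportional to one with coefficients in F.  In
   general, the coefficients of the characteristic polynomial of F(A + t(B - A))
   are polynomials in t over K taking values in F at infinitely many t in F, so
   that their values at t = 0 lie in F.

   If Av = v lambda with v nonzero, then 0 = p(A)v = v p(lambda).  Conversely,
   assume p(lambda) = 0.  If q in F[z] kills A, then p divides q^(nd), so
   q(lambda) = 0.  If v |-> Av - v lambda were injective, it would be killed by
   some h in F[z] with h(0) <> 0, i.e. sum_k A^k v c_k = 0 for all v, where
   sum_k c_k z^k = h(z - lambda).  Since M_n(D) (x)_F D^op acts faithfully on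
   D^n, all coordinates over F of this polynomial kill A, hence vanish at
   lambda, and h(0) = 0. *)

Require Import Defs.
From HB Require Import structures.
From mathcomp Require Import all_boot all_order all_algebra all_field.
From mathcomp.classical Require Import boolp.

Set Implicit Arguments.
Unset Strict Implicit.
Unset Printing Implicit Defensive.

Import GRing.Theory.
Local Open Scope ring_scope.

(** * Polynomials over [K] tested at points of an infinite subfield [F] *)

Definition infinite_type (T : eqType) := forall s : seq T, exists t, t \notin s.

Lemma infinite_uniq_seq (T : eqType) (s : seq T) m : infinite_type T ->
  exists r : seq T, [/\ uniq r, size r = m & forall x, x \in r -> x \notin s].
Proof.
move=> infT; elim: m => [|m [r [Ur <- rs]]]; first by exists [::].
have [t] := infT (s ++ r); rewrite mem_cat negb_or => /andP[ts tr].
exists (t :: r); split=> [||x]; rewrite /= ?tr // inE => /predU1P[->//|/rs].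
by [].
Qed.

Section FieldEmbedding.

Variables (F K : fieldType) (j : {rmorphism F -> K}).

(** A nonzero [p] has fewer than [size p] roots, so one of [size p] distinct points outside [s] is
    not a root. *)
Lemma infinite_nonroot (p : {poly K}) (s : seq F) :
  infinite_type F -> p != 0 -> exists2 t, t \notin s & p.[j t] != 0.
Proof.
move=> infF p0; have [r [Ur sr rs]] := infinite_uniq_seq s (size p) infF.
have : ~~ all (root p) [seq j x | x <- r].
  apply/negP => /(max_poly_roots p0); rewrite size_map sr ltnn.
  by rewrite map_inj_uniq //; [move/(_ Ur) | apply: fmorph_inj].
rewrite all_map => /allPn[t tr pt]; exists t => //; exact: rs.
Qed.

Lemma poly_of_coefs (p : {poly K}) :
  (forall i, exists y, p`_i = j y) -> exists q : {poly F}, p = map_poly j q.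
Proof.
move=> /choice[f fE]; exists (\poly_(i < size p) f i); apply/polyP=> i.
by rewrite coef_map coef_poly /=; case: ltnP => // pi; rewrite rmorph0 nth_default.
Qed.

(** The hypothesis says that infinitely many points of [F] have values in [F]; interpolation at such
    points involves only elements of [F]. *)
Lemma poly_of_values (c : {poly K}) :
    (forall s : seq F, exists2 t, t \notin s & exists y, c.[j t] = j y) ->
  exists q : {poly F}, c = map_poly j q.
Proof.
have [m] := ubnP (size c); elim: m c => // m IHm c cm cP.
have [c0|c0] := eqVneq c 0; first by exists 0; rewrite c0 rmorph0.
have [t0 _ [y0 cy0]] := cP [::].
(* Newton interpolation: the divided difference [c1] satisfies the same
   hypothesis. *)
have [c1 Dc1] : exists c1, c - (j y0)%:P = c1 * ('X - (j t0)%:P).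
  by apply/factor_theorem; rewrite rootE hornerD hornerN hornerC cy0 subrr.
have [|s|q Dq] := IHm c1.
- have [->|c10] := eqVneq c1 0.
    by rewrite size_poly0; move: cm; rewrite ltnS; apply: leq_trans; rewrite size_poly_gt0.
  rewrite -ltnS; apply: leq_trans cm; rewrite ltnS.
  have <- : size (c - (j y0)%:P) = (size c1).+1.
    by rewrite Dc1 size_Mmonic ?monicXsubC // size_XsubC addn2.
  apply: (leq_trans (size_polyD _ _)).
  by rewrite size_polyN geq_max leqnn (leq_trans (size_polyC_leq1 _)) // size_poly_gt0.
- have [t] := cP (t0 :: s); rewrite inE negb_or => /andP[tt0 ts] [y cy].
  exists t => //; exists ((y - y0) / (t - t0)).
  have /(congr1 (fun p => p.[j t])) := Dc1.
  have t0' : j (t - t0) != 0 by rewrite fmorph_eq0 subr_eq0.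
  rewrite !hornerE cy -!rmorphB /= => Dc.
  by rewrite -[LHS](mulfK t0') -Dc fmorph_div.
exists (q * ('X - t0%:P) + y0%:P).
rewrite rmorphD rmorphM /= map_polyXsubC map_polyC /= -Dq -Dc1.
by rewrite subrK.
Qed.

End FieldEmbedding.

(** * Cyclic vectors and annihilating polynomials of matrices *)

(** The columns are [w], [M w], [M^2 w], and so on; over a field, a nonzero determinant means that
    [w] is a cyclic vector of [M]. *)
Definition krylov_mx (R : pzRingType) N (M : 'M[R]_N) (w : 'cV[R]_N) : 'M[R]_N :=
  \matrix_(i, k) (M ^+ k *m w) i 0.

Section Krylov.

Variables (K : fieldType) (N : nat).
Implicit Types (M : 'M[K]_N.+1) (w : 'cV[K]_N.+1).

Lemma map_krylov_mx (R S : nzRingType) (f : {rmorphism R -> S})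
    (M : 'M[R]_N.+1) (w : 'cV[R]_N.+1) :
  map_mx f (krylov_mx M w) = krylov_mx (map_mx f M) (map_mx f w).
Proof.
apply/matrixP=> i k; rewrite mxE [krylov_mx M w i k]mxE [RHS]mxE.
by rewrite -[map_mx f M ^+ k]rmorphXn -map_mxM [RHS]mxE.
Qed.

Lemma det_krylov_line M M' w :
  exists p : {poly K}, forall t, p.[t] = \det (krylov_mx (M + t *: M') w).
Proof.
exists (\det (krylov_mx (map_mx polyC M + 'X *: map_mx polyC M') (map_mx polyC w))).
move=> t; rewrite -[LHS]/(horner_eval t _) -det_map_mx map_krylov_mx.
congr (\det (krylov_mx _ _)); apply/matrixP=> i k.
  by rewrite !mxE /= /horner_eval !hornerE.
by rewrite !mxE /= /horner_eval hornerC.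
Qed.

Lemma horner_mx_coef_wide M (p : {poly K}) m : (size p <= m)%N ->
  horner_mx M p = \sum_(i < m) p`_i *: M ^+ i.
Proof.
move=> pm; rewrite /horner_mx /= /horner_morph.
rewrite (@horner_coef_wide _ m); last by rewrite (leq_trans (size_poly _ _)).
by apply: eq_bigr => i _; rewrite coef_map; apply: mul_scalar_mx.
Qed.

(** The vector [p(M) w] is the Krylov matrix applied to the coefficients of [p], so invertibility
    forces these to vanish. *)
Lemma krylov_annihilator M w (p : {poly K}) : \det (krylov_mx M w) != 0 ->
  (size p <= N.+1)%N -> horner_mx M p = 0 -> p = 0.
Proof.
move=> Mw pN; rewrite (horner_mx_coef_wide M pN) => Mp.
have kp : krylov_mx M w *m (\col_(i < N.+1) p`_i) = 0.
  apply/matrixP=> i k; rewrite !mxE.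
  transitivity ((horner_mx M p *m w) i 0); last first.
    by rewrite (horner_mx_coef_wide M pN) Mp mul0mx mxE.
  rewrite (horner_mx_coef_wide M pN) mulmx_suml summxE; apply: eq_bigr => l _.
  by rewrite -scalemxAl !mxE mulrC.
have {}kp : \col_(i < N.+1) p`_i = 0.
  have U : krylov_mx M w \in unitmx by rewrite unitmxE unitfE.
  by rewrite -[LHS](mulKmx U) kp mulmx0.
apply/polyP=> i; rewrite coef0; have [iN|iN] := ltnP i N.+1.
  by have /matrixP/(_ (Ordinal iN) 0) := kp; rewrite !mxE.
by rewrite nth_default // (leq_trans pN).
Qed.

Lemma krylov_unit_exists : exists M w, \det (krylov_mx M w) != 0.
Proof.
(* [M] is the shift sending each basis vector to the next and the last to 0; starting from the first
   one, the Krylov matrix is the identity. *)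
pose M : 'M[K]_N.+1 := \matrix_(i, k) (i == k.+1 :> nat)%:R.
pose w : 'cV[K]_N.+1 := delta_mx 0 0.
exists M, w; suff -> : krylov_mx M w = 1%:M by rewrite det1 oner_eq0.
have Mw k : (k < N.+1)%N -> M ^+ k *m w = \col_i (i == k :> nat)%:R.
  elim: k => [|k IHk] kN.
    by rewrite expr0 mul1mx; apply/matrixP=> i l; rewrite !mxE ord1 eqxx andbT.
  rewrite exprS -mulmxA IHk 1?ltnW //; apply/matrixP=> i l; rewrite !mxE.
  rewrite (bigD1 (Ordinal (ltnW kN))) //= !mxE /= eqxx mulr1 big1 ?addr0 //.
  by move=> t tk; rewrite !mxE [(_ == k :> nat)](negPf tk) mulr0.
by apply/matrixP=> i k; rewrite mxE Mw // !mxE.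
Qed.

(** [X I - M] divides [p(X) I - p(M)]; the quotient is built along Horner's scheme. *)
Lemma char_poly_mx_dvd M (p : {poly K}) : exists S,
  char_poly_mx M *m S = p%:M - map_mx polyC (horner_mx M p).
Proof.
elim/poly_ind: p => [|p c [S HS]].
  by exists 0; rewrite mulmx0 !rmorph0 subrr.
exists ('X *: S + map_mx polyC (horner_mx M p)).
have hE : horner_mx M (p * 'X + c%:P) = M *m horner_mx M p + c%:M.
  by rewrite rmorphD /= horner_mx_C mulrC rmorphM /= horner_mx_X.
rewrite hE map_mxD map_mxM map_scalar_mx mulmxDr -scalemxAr HS.
rewrite mulmxBl mul_scalar_mx scalerBr addrA subrK mulrC.
by rewrite raddfD /= -[('X * p)%:M]scale_scalar_mx opprD addrACA subrr addr0.
Qed.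

(** When [p(M) = 0], take determinants in the factorization of [p(X) I]. *)
Lemma char_poly_dvd_exp M (p : {poly K}) :
  horner_mx M p = 0 -> char_poly M %| p ^+ N.+1.
Proof.
move=> Mp; have [S /(congr1 determinant)] := char_poly_mx_dvd M p.
by rewrite Mp map_mx0 subr0 det_mulmx det_scalar => <-; apply: dvdp_mulr.
Qed.

End Krylov.

(** * The base field inside a maximal subfield *)

Lemma mulmx_scalarE (R : pzRingType) m (X : 'cV[R]_m) (c : R) i :
  (X *m c%:M) i 0 = X i 0 * c.
Proof. by rewrite mxE big_ord1 mxE eqxx mulr1n. Qed.

(** [K] is an abstract field with no given link to [F]; maximality of its image provides the
    embedding [j]. *)
Lemma maximal_subfield_base (F : fieldType) (D : falgType F) (K : fieldType)
    (iota : {rmorphism K -> D}) : maximal_subfield iota ->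
  exists j : {rmorphism F -> K}, forall x, iota (j x) = x%:A.
Proof.
move=> maxK.
(* The double centralizer of [iota K] is a subfield containing the center. *)
pose C := [pred y : D | `[< forall k, y * iota k = iota k * y >]].
pose T := [pred x : D | `[< forall y, y \in C -> x * y = y * x >]].
have CP y k : y \in C -> y * iota k = iota k * y by move/asboolP.
have TP x y : x \in T -> y \in C -> x * y = y * x by move/asboolP; apply.
have iotaT k : iota k \in T by apply/asboolP=> y yC; rewrite CP.
have TC x : x \in T -> x \in C.
  move=> xT; apply/asboolP=> k; apply: TP => //; apply/asboolP=> l.
  by rewrite -!rmorphM mulrC.
have Tsub : subfield_pred T.
  split=> [|x y xT yT]; last by apply: TP; rewrite ?TC.
  split=> [|x y xT yT|x y xT yT].
  - by apply/asboolP=> y _; rewrite mul1r mulr1.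
  - by apply/asboolP=> z zC; rewrite mulrBl mulrBr !(TP _ z).
  - apply/asboolP=> z zC.
    by rewrite -mulrA -(commrV (esym (TP y z yT zC))) mulrA (TP x z) // mulrA.
have FT (x : F) : exists k, iota k == x%:A.
  have /(maxK T Tsub iotaT)[k kx] : x%:A \in T; last by exists k; apply/eqP.
  by apply/asboolP=> y _; rewrite mulr_algl mulr_algr.
pose j x := xchoose (FT x).
have jE x : iota (j x) = x%:A := eqP (xchooseP (FT x)).
have jB : zmod_morphism j.
  by move=> x y; apply: (fmorph_inj iota); rewrite rmorphB !jE scalerBl.
have jM : monoid_morphism j.
  split=> [|x y]; apply: (fmorph_inj iota); first by rewrite jE rmorph1 scale1r.
  by rewrite rmorphM !jE -scalerAl mul1r scalerA.
pose jR : {rmorphism F -> K} :=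
  HB.pack j (GRing.isZmodMorphism.Build F K j jB)
            (GRing.isMonoidMorphism.Build F K j jM).
by exists jR.
Qed.

(** * Faithfulness of the two-sided action on [D] and on columns *)

Section CentralDivisionAlgebra.

Variables (F : fieldType) (D : falgType F).
Hypothesis divD : forall x : D, x != 0 -> x \is a GRing.unit.
Hypothesis cenD : ('Z({:D}) = 1)%VS.

Let e := vbasis {:D}.

Lemma central_scalar (x : D) : (forall y, x * y = y * x) -> exists a : F, x = a%:A.
Proof.
move=> xC; apply/vlineP; rewrite -cenD memv_cap memvf /=.
by apply/centvP=> y _; rewrite xC.
Qed.

Lemma divD_mulf_eq0 (x y : D) : x != 0 -> x * y = 0 -> y = 0.
Proof. by move=> /divD xU xy; rewrite -[y](mulKr xU) xy mulr0. Qed.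

(** Shortest-relation argument: scale one coefficient to 1; the commutators of the coefficients with
    any [d] form a shorter relation, so they vanish. The coefficients are then central, hence in
    [F], and [v = 1] contradicts the freeness of the basis. *)
Lemma vbasis_relation_trivial (y : 'I_(\dim {:D}) -> D) :
  (forall v, \sum_s y s * v * e`_s = 0) -> forall s, y s = 0.
Proof.
have [m] := ubnP #|[set s | y s != 0]|; elim: m y => // m IHm y ym yR s0.
apply/eqP/negPn/negP => ys0; have yU := divD ys0.
pose z s := (y s0)^-1 * y s.
have zR v : \sum_s z s * v * e`_s = 0.
  transitivity ((y s0)^-1 * \sum_s y s * v * e`_s); last by rewrite yR mulr0.
  rewrite mulr_sumr.
  by apply: eq_bigr => s _; rewrite !mulrA.
have z_comm d s : d * z s = z s * d.
  apply/eqP; rewrite -subr_eq0; apply/eqP.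
  apply: (IHm (fun s => d * z s - z s * d)) => [|v]; last first.
    transitivity (d * (\sum_t z t * v * e`_t) - \sum_t z t * (d * v) * e`_t).
      rewrite mulr_sumr -sumrB.
      by apply: eq_bigr => t _; rewrite !mulrBl !mulrA.
    by rewrite !zR mulr0 subrr.
  rewrite -ltnS; apply: leq_trans ym; rewrite ltnS; apply: proper_card.
  apply/properP; split; last first.
    by exists s0; rewrite !inE // /z mulVr // mulr1 mul1r subrr eqxx.
  apply/subsetP=> t; rewrite !inE; apply: contra_neq => yt.
  by rewrite /z yt !mulr0 mul0r subrr.
have [a za] : exists a : _ -> F, forall s, z s = (a s)%:A.
  by apply: (fin_all_exists (P := fun s b => z s = b%:A)) => s; apply: central_scalar => d; rewrite z_comm.
have /freeP/(_ a) fr := basis_free (vbasisP {:D}).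
have a0 : a s0 = 0.
  apply: fr; rewrite -[RHS](zR 1); apply: eq_bigr => s _.
  by rewrite mulr1 za mulr_algl.
by have := za s0; rewrite a0 scale0r /z mulVr // => /eqP; rewrite oner_eq0.
Qed.

Lemma coord_vbasis_full (x : D) : x = \sum_s coord e s x *: e`_s.
Proof. exact/coord_vbasis/memvf. Qed.

(* [x (x) c |-> (v |-> x v c)] embeds [D (x) D^op] in the endomorphisms of [D];
   the conclusion says that the tensor [sum_k x_k (x) c_k] is zero. *)
Lemma bimodule_faithful (I : finType) (x c : I -> D) :
    (forall v, \sum_k x k * v * c k = 0) ->
  forall s, \sum_k coord e s (c k) *: x k = 0.
Proof.
move=> xcR; apply: vbasis_relation_trivial => v; rewrite -[RHS](xcR v).
under eq_bigr do rewrite !mulr_suml.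
rewrite exchange_big; apply: eq_bigr => k _ /=.
rewrite [in RHS](coord_vbasis_full (c k)) mulr_sumr; apply: eq_bigr => s _.
by rewrite -!scalerAl scalerAr.
Qed.

Lemma bimodule_faithful_mx n (I : finType) (M : I -> 'M[D]_n) (c : I -> D) :
    (forall v : 'cV_n, \sum_k M k *m v *m (c k)%:M = 0) ->
  forall s, \sum_k (coord e s (c k))%:A *: M k = 0.
Proof.
move=> McR s; apply/matrixP=> i l; rewrite summxE mxE.
transitivity (\sum_k coord e s (c k) *: M k i l).
  by apply: eq_bigr => k _; rewrite mxE mulr_algl.
apply: (bimodule_faithful (fun v => _)) => v.
(* A column supported at [l] isolates the entry [(i, l)] of each [M k]. *)
have /matrixP/(_ i 0) := McR (\col_i0 (v *+ (i0 == l))); rewrite summxE mxE => {2}<-.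
apply: eq_bigr => k _; rewrite mulmx_scalarE; congr (_ * _).
rewrite mxE (bigD1 l) //= mxE eqxx big1 ?addr0 // => t tl.
by rewrite mxE (negPf tl) mulr0.
Qed.

End CentralDivisionAlgebra.

(* [A] acts on the left and the coefficients on the right of [v]. *)
Definition bimod_horner (R : nzRingType) n (A : 'M[R]_n) (c : {poly R})
    (v : 'cV[R]_n) : 'cV[R]_n :=
  \sum_(k < size c) A ^+ k *m v *m (c`_k)%:M.

Lemma bimod_horner_wide (R : nzRingType) n (A : 'M[R]_n) (c : {poly R}) v m :
  (size c <= m)%N -> bimod_horner A c v = \sum_(k < m) A ^+ k *m v *m (c`_k)%:M.
Proof.
move=> cm; rewrite /bimod_horner (big_ord_widen m (fun k => A ^+ k *m v *m (c`_k)%:M)) //.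
rewrite big_mkcond; apply: eq_bigr => k _; case: ltnP => // ck.
by rewrite nth_default // raddf0 mulmx0.
Qed.

(** * Matrices over [K] representing matrices over [D], and descent of the characteristic polynomial
    to [F] *)

Section Representation.

Variables (F : fieldType) (D : falgType F).
Hypothesis divD : forall x : D, x != 0 -> x \is a GRing.unit.
Hypothesis cenD : ('Z({:D}) = 1)%VS.

Let e := vbasis {:D}.

Variables (K : fieldType) (iota : {rmorphism K -> D}) (j : {rmorphism F -> K}).
Hypothesis iota_j : forall x, iota (j x) = x%:A.

Variables (n N : nat) (g : 'cV[D]_n -> 'cV[K]_N.+1).
Hypothesis g_iso : right_linear_iso iota g.

Lemma right_linear_isoD u v : g (u + v) = g u + g v.
Proof. by case: g_iso. Qed.

Lemma right_linear_iso0 : g 0 = 0.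
Proof. by apply: (addrI (g 0)); rewrite -right_linear_isoD !addr0. Qed.

Lemma right_linear_iso_sum (I : Type) (r : seq I) (f : I -> 'cV[D]_n) :
  g (\sum_(i <- r) f i) = \sum_(i <- r) g (f i).
Proof. exact: (big_morph g right_linear_isoD right_linear_iso0). Qed.

Lemma right_linear_isoZ v mu : g (v *m (iota mu)%:M) = mu *: g v.
Proof. by case: g_iso => _ _ ->; rewrite mul_mx_scalar. Qed.

Lemma right_linear_iso_eq0 v : g v = 0 -> v = 0.
Proof. by case: g_iso => /bij_inj gI _ _; rewrite -right_linear_iso0 => /gI. Qed.

Lemma right_linear_iso_mx_eq0 (M : 'M[K]_N.+1) : (forall v, M *m g v = 0) -> M = 0.
Proof.
case: g_iso => [[h _ hK]] _ _ M0; apply/matrixP=> i k.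
have := M0 (h (delta_mx k 0)); rewrite hK -colE => /matrixP/(_ i 0).
by rewrite !mxE.
Qed.

Lemma mulmx_base m (X : 'cV[D]_m) (a : F) : X *m (a%:A)%:M = a%:A *: X.
Proof.
by apply/matrixP=> i k; rewrite ord1 mulmx_scalarE mxE mulr_algl mulr_algr.
Qed.

Lemma represents_line A B M M' x : represents g A M -> represents g B M' ->
  represents g (A + x%:A *: B) (M + j x *: M').
Proof.
move=> AM BM v; rewrite !mulmxDl right_linear_isoD AM -!scalemxAl.
by rewrite -mulmx_base -iota_j right_linear_isoZ BM.
Qed.

Lemma represents_exp A M k : represents g A M -> represents g (A ^+ k) (M ^+ k).
Proof.
move=> AM; elim: k => [|k IHk] v; first by rewrite !expr0 !mul1mx.
by rewrite !exprS -!mulmxA AM IHk.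
Qed.

Lemma represents_horner A M (p : {poly K}) v : represents g A M ->
  g (bimod_horner A (map_poly iota p) v) = horner_mx M p *m g v.
Proof.
move=> AM; rewrite (@bimod_horner_wide _ _ _ _ _ (size p)) ?size_poly //.
rewrite right_linear_iso_sum (horner_mx_coef_wide _ (leqnn _)) mulmx_suml.
apply: eq_bigr => k _.
by rewrite coef_map right_linear_isoZ (represents_exp k AM) scalemxAl.
Qed.

(** By faithfulness, each coordinate over [F] of a two-sided relation for [A] is itself a relation
    for [A]. Its coefficients are central, so it passes to [M]. *)
Lemma represents_annihilator A M (c : {poly D}) : represents g A M ->
  (forall v, bimod_horner A c v = 0) ->
  forall s, horner_mx M (map_poly j (map_poly (coord e s) c)) = 0.
Proof.
move=> AM Ac s; apply: right_linear_iso_mx_eq0 => v.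
rewrite -(represents_horner _ _ AM) -map_poly_comp.
rewrite (eq_map_poly (g := in_alg D)) // (@bimod_horner_wide _ _ _ _ _ (size c)); last first.
  by rewrite (leq_trans (size_poly _ _)) ?size_poly.
transitivity (g ((\sum_(k < size c) (coord e s c`_k)%:A *: A ^+ k) *m v)).
  congr (g _); rewrite mulmx_suml; apply: eq_bigr => k _.
  by rewrite !coef_map_id0 ?linear0 ?rmorph0 //= mulmx_base scalemxAl.
by rewrite (bimodule_faithful_mx divD cenD Ac) mul0mx right_linear_iso0.
Qed.

Definition representable (M : 'M[K]_N.+1) := exists A, represents g A M.

Lemma representable_line M M' x : representable M -> representable M' ->
  representable (M + j x *: M').
Proof. by move=> [A AM] [B BM]; exists (A + x%:A *: B); apply: represents_line. Qed.

(** This is the surjectivity of [M_n(D) (x)_F K -> M_nd(K)]. Faithfulness makes the images of an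
    [F]-basis of [M_n(D)] independent over [K], and the dimension hypothesis makes their number that
    of all matrix entries. *)
Lemma representable_span : (n ^ 2 * \dim {:D} = N.+1 ^ 2)%N ->
  exists (I : finType) (X : I -> 'M[K]_N.+1),
    (forall i, representable (X i)) /\
    forall M, exists k : I -> K, M = \sum_i k i *: X i.
Proof.
move=> dimD; pose I : finType := ('I_n * 'I_n * 'I_(\dim {:D}))%type.
pose E (i : I) : 'M[D]_n := e`_i.2 *: delta_mx i.1.1 i.1.2.
have [X EX] : exists X : I -> 'M[K]_N.+1, forall i, represents g (E i) (X i).
  apply: (fin_all_exists (P := fun i M => represents g (E i) M)) => i.
  by have [M []] := represents_exists_unique (E i) g_iso; exists M.
exists I, X; split=> [i|M]; first by exists (E i).
have indep (k : I -> K) : \sum_i k i *: X i = 0 -> forall i, k i = 0.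
  move=> kX [[a b] s].
  have kE (v : 'cV[D]_n) : \sum_i E i *m v *m (iota (k i))%:M = 0.
    apply: right_linear_iso_eq0; rewrite right_linear_iso_sum.
    rewrite -[RHS](mul0mx _ (g v)) -kX mulmx_suml; apply: eq_bigr => i _.
    by rewrite right_linear_isoZ EX scalemxAl.
  apply/eqP; rewrite -(fmorph_eq0 iota) (coord_vbasis_full (iota _)) big1 // => t _.
  have /freeP/(_ (fun s => coord e t (iota (k (a, b, s))))) fr := basis_free (vbasisP {:D}).
  rewrite fr ?scale0r //.
  (* For fixed [t], the entry [(a, b)] is a combination over [F] of the basis vectors of [D], so its
     coefficients vanish. *)
  have /matrixP/(_ a b) := bimodule_faithful_mx divD cenD kE t.
  rewrite summxE [RHS]mxE => kE0; rewrite -[RHS]kE0.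
  rewrite [RHS](bigID (fun i : I => i.1 == (a, b))) /= [X in _ + X]big1 ?addr0; last first.
    move=> [[a' b'] s'] /=; rewrite xpair_eqE => /negPf abF.
    by rewrite !mxE [a == _]eq_sym [b == _]eq_sym abF mulr0 mulr0.
  rewrite (reindex_onto (fun s => ((a, b), s)) (fun i => i.2)) /=; last first.
    by move=> [[a' b'] s'] /= /eqP[-> ->].
  apply: eq_big => [s'|s' _]; first by rewrite !eqxx.
  by rewrite !mxE !eqxx mulr1 mulr_algl.
pose W : 'M[K]_(#|I|, N.+1 * N.+1) := \matrix_r mxvec (X (enum_val r)).
have WE (u : 'rV_#|I|) : u *m W = mxvec (\sum_i u 0 (enum_rank i) *: X i).
  rewrite mulmx_sum_row linear_sum /= (reindex enum_rank) /=; last first.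
    exact/onW_bij/enum_rank_bij.
  by apply: eq_bigr => i _; rewrite rowK enum_rankK linearZ.
have Wfree : row_free W.
  apply: inj_row_free => u; rewrite WE => /(canRL mxvecK); rewrite linear0.
  move=> /indep u0; apply/rowP=> r.
  by rewrite mxE -(enum_valK r) u0.
have Wfull : row_full W.
  rewrite /row_full (eqP Wfree) !card_prod !card_ord; apply/eqP.
  by rewrite !mulnn dimD.
have /submxP[u /(canRL mxvecK)] := submx_full (mxvec M) Wfull.
rewrite WE mxvecK => ->; exists (fun i => u 0 (enum_rank i)) => //.
Qed.

(** Density: having [w] as a cyclic vector is a polynomial condition on the [K]-coordinates,
    satisfied by some matrix, hence also at a point with coordinates in the infinite field [F]. *)
Lemma krylov_representable : infinite_type F -> (n ^ 2 * \dim {:D} = N.+1 ^ 2)%N ->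
  exists2 M, representable M & exists w, \det (krylov_mx M w) != 0.
Proof.
move=> infF /representable_span[I [X [Xrep Xspan]]].
have [M0 [w M0w]] := krylov_unit_exists K N.
have [k M0E] := Xspan M0.
(* The coordinates of [M0] are moved from [K] to [F] one at a time. *)
suff gen (r : seq I) Y : representable Y ->
    \det (krylov_mx (Y + \sum_(i <- r) k i *: X i) w) != 0 ->
    exists2 M, representable M & \det (krylov_mx M w) != 0.
  have [||M Mrep Mw] := gen (index_enum I) 0; last by exists M => //; exists w.
    by exists 0 => v; rewrite !mul0mx right_linear_iso0.
  by rewrite add0r -M0E.
elim: r Y => [|i r IHr] Y Yrep; first by rewrite big_nil addr0; exists Y.
rewrite big_cons addrA addrAC => Yw.
have [p pE] := det_krylov_line (Y + \sum_(i <- r) k i *: X i) (X i) w.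
have p0 : p != 0 by apply: contraNneq Yw => p0; rewrite -pE p0 horner0.
have [t _ pt] := infinite_nonroot j [::] infF p0.
apply: (IHr (Y + j t *: X i)); first exact: representable_line.
by rewrite addrAC -pE.
Qed.

(** Cayley-Hamilton, read in [D] and split into coordinates over [F], yields polynomials [q s] over
    [F] killing [M]. Independence of the powers of [M] makes them multiples of [p]. *)
Lemma krylov_char_poly_base M w : representable M -> \det (krylov_mx M w) != 0 ->
  exists q, char_poly M = map_poly j q.
Proof.
move=> [A AM] Mw; set p := char_poly M.
have Ap v : bimod_horner A (map_poly iota p) v = 0.
  apply: right_linear_iso_eq0.
  by rewrite (represents_horner _ _ AM) Cayley_Hamilton mul0mx.
pose q s := map_poly (coord e s) (map_poly iota p).
have q_coef s i : (q s)`_i = coord e s (iota p`_i).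
  by rewrite coef_map_id0 ?linear0 // coef_map.
have qp s : map_poly j (q s) = j (coord e s 1) *: p.
  apply/eqP; rewrite -subr_eq0; apply/eqP.
  apply: (krylov_annihilator Mw); last first.
    have qM : horner_mx M (map_poly j (q s)) = 0 := represents_annihilator AM Ap s.
    have pM : horner_mx M p = 0 := Cayley_Hamilton M.
    by rewrite -mul_polyC rmorphB rmorphM /= qM pM mulr0 subrr.
  apply/leq_sizeP => i Ni; rewrite coefB coefZ coef_map /= q_coef.
  (* Since [p] is monic, both sides have the same coefficient in degree [N.+1]; their difference is
     short enough for [krylov_annihilator]. *)
  have [->|Ni'] := eqVneq i N.+1.
    have -> : p`_N.+1 = 1.
      by have /monicP := char_poly_monic M; rewrite lead_coefE size_char_poly.
    by rewrite rmorph1 mulr1 subrr.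
  have {Ni Ni'}Ni : (size p <= i)%N by rewrite size_char_poly ltn_neqAle eq_sym Ni' Ni.
  by rewrite [p`_i]nth_default // rmorph0 linear0 rmorph0 mulr0 subrr.
have [s s1] : exists s, coord e s 1 != 0.
  apply/existsP; apply: contraT; rewrite negb_exists => /forallP c0.
  have /eqP := coord_vbasis_full (1 : D); rewrite big1 ?oner_eq0 // => s _.
  by have /eqP-> := negPn (c0 s); rewrite scale0r.
exists ((coord e s 1)^-1 *: q s).
by rewrite map_polyZ fmorphV qp scalerA mulVf ?scale1r // fmorph_eq0.
Qed.

Lemma char_poly_base_infinite M : infinite_type F ->
    (n ^ 2 * \dim {:D} = N.+1 ^ 2)%N -> representable M ->
  exists q, char_poly M = map_poly j q.
Proof.
move=> infF dimD Mrep; have [M' M'rep [w M'w]] := krylov_representable infF dimD.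
pose L t := M + t *: (M' - M).
have Lrep t : representable (L (j t)).
  apply: representable_line => //; rewrite addrC -scaleN1r -(rmorph1 j) -rmorphN addrC.
  exact: representable_line.
have [p pE] := det_krylov_line M (M' - M) w.
(* The line [L] passes through [M'] at 1, where [p] does not vanish. *)
have p0 : p != 0.
  by apply: contraNneq M'w => p0; rewrite -[M'](subrK M) addrC -[M' - M]scale1r -pE p0 horner0.
(* The characteristic polynomial of the generic point of the line: its coefficients are polynomials
   in [t]. *)
pose P := char_poly (map_mx polyC M + 'X *: map_mx polyC (M' - M)).
have PE t : map_poly (horner_eval t) P = char_poly (L t).
  rewrite map_char_poly; congr char_poly; apply/matrixP=> i k.
  by rewrite !mxE /= /horner_eval !hornerE.
have coefP i : exists q, P`_i = map_poly j q.
  apply: poly_of_values => s.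
  have [t ts pt] := infinite_nonroot j s infF p0; exists t => //.
  have [|q qE] := @krylov_char_poly_base (L (j t)) w (Lrep t); first by rewrite -pE.
  exists q`_i; rewrite -[LHS]/(horner_eval _ _) -coef_map PE qE.
  exact: coef_map.
apply: poly_of_coefs => i; have [q qE] := coefP i; exists q.[0].
have -> : M = L 0 by rewrite /L scale0r addr0.
by rewrite -PE coef_map /= /horner_eval qE -{1}(rmorph0 j) horner_map.
Qed.

End Representation.

(** * The case of a finite base field *)

Lemma finite_division_algebra_comm (F : fieldType) (D : falgType F) :
    (forall x : D, x != 0 -> x \is a GRing.unit) -> ~ infinite_type F ->
  commutative (@GRing.mul D).
Proof.
move=> divD /asboolPn/existsp_asboolPn[s sP].
have {sP}sP (x : F) : x \in s.
  by apply: contraT => xs; case: sP; exists x.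
pose e := vbasis {:D}.
(* All combinations of the basis with coefficients from [s], which lists [F]: this enumerates [D],
   so that Wedderburn's little theorem applies. *)
pose r : seq D := [seq \sum_i val (f i) *: e`_i | f : {ffun 'I_(\dim {:D}) -> seq_sub s}].
have rP (x : D) : x \in r.
  apply/imageP; exists [ffun i => SeqSub (sP (coord e i x))] => //.
  by rewrite [LHS](coord_vbasis_full x); apply: eq_bigr => i _; rewrite ffunE.
have rK : cancel (index^~ r) (nth 0 r) by move=> x; apply: nth_index.
have r_enum : Finite.axiom (undup r).
  by move=> x; rewrite count_uniq_mem ?undup_uniq // mem_undup rP.
pose DC := Choice_isCountable.Build D (can_pcan rK).
pose DF : finUnitRingType := HB.pack D DC (isFinite.Build D r_enum).
have domD : GRing.integral_domain_axiom D.
  move=> x y xy; have [//|x0] := eqVneq x 0.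
  by rewrite (divD_mulf_eq0 divD x0 xy) eqxx.
exact: (@finDomain_mulrC DF domD).
Qed.

(** * Polynomials killing the operator [v |-> A v - v a] *)

(** The constant coefficient of the characteristic polynomial is the determinant up to sign. In size
    0, where every matrix is zero, [1] serves. *)
Lemma unitmx_annihilator (F : fieldType) m (M : 'M[F]_m) : M \in unitmx ->
  exists2 h : {poly F}, h`_0 != 0 & \sum_(i < size h) h`_i *: M ^+ i = 0.
Proof.
case: m M => [|m] M; last rewrite unitmxE unitfE => M0.
  by exists 1; [rewrite coef1 oner_eq0 | rewrite [LHS]flatmx0].
exists (char_poly M).
  by rewrite char_poly_det mulf_neq0 ?signr_eq0.
by rewrite -horner_mx_coef_wide ?Cayley_Hamilton.
Qed.

Section LinearOperator.

Import VectorInternalTheory.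

Lemma injective_linear_annihilator (F : fieldType) (V : vectType F)
    (T : {linear V -> V}) : injective T ->
  exists2 h : {poly F}, h`_0 != 0 &
    forall v, \sum_(i < size h) h`_i *: iter i T v = 0.
Proof.
move=> T_inj; pose M := lin1_mx (v2r \o T \o r2v).
have ME (u : V) : v2r u *m M = v2r (T u) by rewrite mul_rV_lin1 /= v2rK.
have MX i (u : V) : v2r u *m M ^+ i = v2r (iter i T u).
  elim: i => [|i IHi]; first by rewrite expr0 mulmx1.
  by rewrite exprSr mulmxA IHi ME.
have [|h h0 hM] := @unitmx_annihilator _ _ M.
  rewrite -row_free_unit; apply: inj_row_free => u.
  rewrite -[u]r2vK ME -(linear0 v2r) => /(can_inj v2rK).
  by move=> Tu; rewrite (T_inj (r2v u) 0) // Tu linear0.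
exists h => // v; apply: (can_inj v2rK).
rewrite linear0 -[RHS](mulmx0 _ (v2r v)) -hM mulmx_sumr linear_sum.
by apply: eq_bigr => i _; rewrite -scalemxAr MX linearZ.
Qed.

End LinearOperator.

Section BimodHorner.

Variables (R : nzRingType) (n : nat).
Implicit Types (A : 'M[R]_n) (c : {poly R}) (v : 'cV[R]_n).

Lemma bimod_hornerD A c1 c2 v :
  bimod_horner A (c1 + c2) v = bimod_horner A c1 v + bimod_horner A c2 v.
Proof.
pose m := maxn (size c1) (size c2).
rewrite !(@bimod_horner_wide _ _ _ _ _ m) ?size_polyD ?leq_maxl ?leq_maxr //.
by rewrite -big_split; apply: eq_bigr => k _; rewrite coefD raddfD mulmxDr.
Qed.

Lemma bimod_hornerMX A c v : bimod_horner A (c * 'X) v = A *m bimod_horner A c v.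
Proof.
rewrite (@bimod_horner_wide _ _ _ _ _ (size c).+1); last first.
  by apply: leq_trans (size_polyMleq _ _) _; rewrite size_polyX addn2.
rewrite big_ord_recl coefMX raddf0 mulmx0 add0r mulmx_sumr.
by apply: eq_bigr => k _; rewrite coefMX /= exprS !mulmxA.
Qed.

Lemma bimod_hornerMC A c v a :
  bimod_horner A (c * a%:P) v = bimod_horner A c v *m a%:M.
Proof.
rewrite (@bimod_horner_wide _ _ _ _ _ (size c)); last first.
  apply: leq_trans (size_polyMleq _ _) _; rewrite -subn1 leq_subLR addnC.
  by rewrite leq_add2r size_polyC_leq1.
by rewrite mulmx_suml; apply: eq_bigr => k _; rewrite coefMC scalar_mxM mulmxA.
Qed.

(** Multiplying a polynomial on the right by ['X] adds a left action of [A], and by [a%:P] a right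
    action of [a]; thus ['X - a%:P] acts as the operator. *)
Lemma bimod_horner_XsubC_exp A a i v :
  bimod_horner A (('X - a%:P) ^+ i) v = iter i (fun u => A *m u - u *m a%:M) v.
Proof.
elim: i => [|i IHi]; first by rewrite /bimod_horner size_poly1 big_ord1 coef1 mul1mx mulmx1.
rewrite exprSr; move: (_ ^+ i) IHi => c IHi.
rewrite mulrBr -mulrN -polyCN bimod_hornerD bimod_hornerMX bimod_hornerMC.
by rewrite IHi raddfN mulmxN.
Qed.

End BimodHorner.

Lemma bimod_horner_sum_base (F : fieldType) (D : falgType F) n (A : 'M[D]_n)
    (I : Type) (r : seq I) (a : I -> F) (c : I -> {poly D}) v :
  bimod_horner A (\sum_(i <- r) (a i)%:A *: c i) v =
  \sum_(i <- r) (a i)%:A *: bimod_horner A (c i) v.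
Proof.
elim: r => [|i r IHr]; first by rewrite !big_nil /bimod_horner size_poly0 big_ord0.
rewrite !big_cons bimod_hornerD IHr; congr (_ + _).
rewrite (@bimod_horner_wide _ _ _ _ _ (size (c i))) ?size_scale_leq // scaler_sumr.
apply: eq_bigr => k _; rewrite coefZ -[RHS]mulmx_base -[RHS]mulmxA -scalar_mxM.
by rewrite mulr_algl mulr_algr.
Qed.

(** If [h] kills the operator and [h(0)] is nonzero, then [c = h(X - a)] kills [A] in the two-sided
    sense, and [c(a) = h(0)]. *)
Lemma injective_sylvester_annihilator (F : fieldType) (D : falgType F) n
    (A : 'M[D]_n) (a : D) :
    (forall v : 'cV_n, A *m v = v *m a%:M -> v = 0) ->
  exists2 c : {poly D}, c.[a] != 0 & forall v, bimod_horner A c v = 0.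
Proof.
move=> Aa; pose T (v : 'cV[D]_n) := A *m v - v *m a%:M.
(* Columns form a module over [D]; finite functions form a vector space over [F], to which [T] is
   transported. *)
pose col (x : {ffun 'I_n -> D}) := \col_i x i.
pose Tf (x : {ffun 'I_n -> D}) := [ffun i => T (col x) i 0].
have colT x : col (Tf x) = T (col x).
  by apply/matrixP=> i k; rewrite mxE ffunE ord1.
have colZ b x : col (b *: x) = b%:A *: col x.
  by apply/matrixP=> i k; rewrite !mxE ffunE mulr_algl.
have colD x y : col (x + y) = col x + col y.
  by apply/matrixP=> i k; rewrite !mxE ffunE.
have col0 : col 0 = 0 by apply/matrixP=> i k; rewrite !mxE ffunE.
have col_inj : injective col.
  by move=> x y /matrixP xy; apply/ffunP=> i; have := xy i 0; rewrite !mxE.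
have Tf_lin : linear Tf.
  move=> b x y; apply: col_inj; rewrite colD colZ !colT colD colZ /T.
  rewrite mulmxDr mulmxDl opprD addrACA scalerBr; congr (_ - _ + _).
    by rewrite -!mulmx_base mulmxA.
  by rewrite scalemxAl.
pose TL : {linear _ -> _} := HB.pack Tf (GRing.isLinear.Build _ _ _ _ Tf Tf_lin).
have TL_inj : injective TL.
  move=> x y xy; have Txy : Tf (x - y) = 0.
    by rewrite -[LHS]/(TL _) linearB xy subrr.
  apply/eqP; rewrite -subr_eq0; apply/eqP/col_inj; rewrite col0.
  apply: Aa; apply/eqP; rewrite -subr_eq0 -[_ - _]/(T _) -colT.
  by rewrite Txy col0.
have [h h0 hT] := injective_linear_annihilator TL_inj.
exists (\sum_(i < size h) (h`_i)%:A *: ('X - a%:P) ^+ i) => [|v].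
  have h_gt0 : (0 < size h)%N.
    by rewrite lt0n size_poly_eq0; apply: contraNneq h0 => ->; rewrite coef0.
  rewrite horner_sum (bigD1 (Ordinal h_gt0)) //= big1 ?addr0 => [|i i0].
    by rewrite hornerZ hornerC mulr1 scaler_eq0 negb_or h0 oner_eq0.
  have {i0} : (0 < i)%N by rewrite lt0n.
  case: (nat_of_ord i) => // k _; rewrite hornerZ exprSr.
  (* Evaluation at [a] is multiplicative here although [D] need not be commutative: the last factor
     has value 0, which commutes with [a]. *)
  rewrite hornerM_comm /comm_poly hornerXsubC subrr ?mul0r ?mulr0 //.
rewrite bimod_horner_sum_base.
have colI i x : col (iter i TL x) = iter i T (col x).
  by elim: i => //= i <-; rewrite -colT.
have [x ->] : exists x, v = col x.
  by exists [ffun i => v i 0]; apply/matrixP=> i k; rewrite mxE ffunE ord1.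
rewrite -[RHS]col0 -[in RHS](hT x) (big_morph col colD col0).
by apply: eq_bigr => i _; rewrite colZ bimod_horner_XsubC_exp colI.
Qed.

Lemma horner_alg_coef_wide (F : fieldType) (D : algType F) (x : D) (q : {poly F}) m :
  (size q <= m)%N -> horner_alg x q = \sum_(k < m) q`_k *: x ^+ k.
Proof.
move=> qm; rewrite /horner_alg /horner_morph (@horner_coef_wide _ m); last first.
  by rewrite (leq_trans (size_poly _ _)).
by apply: eq_bigr => k _; rewrite coef_map /= mulr_algl.
Qed.

Lemma bimod_horner_eigenvector (F : fieldType) (D : falgType F) n (A : 'M[D]_n)
    (a : D) (v : 'cV[D]_n) (q : {poly F}) : A *m v = v *m a%:M ->
  bimod_horner A (map_poly (in_alg D) q) v = v *m (horner_alg a q)%:M.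
Proof.
move=> Av; have AX k : A ^+ k *m v = v *m (a ^+ k)%:M.
  elim: k => [|k IHk]; first by rewrite !expr0 mul1mx mulmx1.
  by rewrite exprSr exprS -mulmxA Av mulmxA IHk -mulmxA -scalar_mxM -exprSr exprS.
rewrite (@bimod_horner_wide _ _ _ _ _ (size q)) ?size_poly //.
rewrite (horner_alg_coef_wide _ (leqnn _)) raddf_sum mulmx_sumr.
by apply: eq_bigr => k _; rewrite coef_map AX -mulmxA -scalar_mxM /= mulr_algr.
Qed.

(** * Right eigenvalues as roots of the characteristic polynomial *)

Section Eigenvalues.

Variables (F : fieldType) (D : falgType F).
Hypothesis divD : forall x : D, x != 0 -> x \is a GRing.unit.
Hypothesis cenD : ('Z({:D}) = 1)%VS.

Variables (K : fieldType) (iota : {rmorphism K -> D}) (j : {rmorphism F -> K}).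
Hypothesis iota_j : forall x, iota (j x) = x%:A.

Variables (n N : nat) (g : 'cV[D]_n -> 'cV[K]_N.+1).
Hypothesis g_iso : right_linear_iso iota g.
Hypothesis dimD : (n ^ 2 * \dim {:D} = N.+1 ^ 2)%N.

Lemma char_poly_base A M : represents g A M -> exists q, char_poly M = map_poly j q.
Proof.
move=> AM; have [infF|finF] := EM (infinite_type F).
  apply: (char_poly_base_infinite divD cenD iota_j g_iso infF dimD).
  by exists A.
(* For finite [F], [D] is commutative, so every coefficient is central and lies in [F]. *)
apply: poly_of_coefs => i.
have [|b ib] := central_scalar cenD (x := iota (char_poly M)`_i).
  by move=> y; apply: finite_division_algebra_comm.
by exists b; apply: (fmorph_inj iota); rewrite iota_j.
Qed.

Lemma right_eigenvalue_base_poly A M (a : D) (q : {poly F}) :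
    represents g A M -> char_poly M = map_poly j q ->
  right_eigenvalue A a <-> horner_alg a q = 0.
Proof.
move=> AM Mq; split=> [[v v0 Av] | aq].
  have : bimod_horner A (map_poly (in_alg D) q) v = 0.
    rewrite -(eq_map_poly iota_j) map_poly_comp -Mq.
    apply: (right_linear_iso_eq0 g_iso).
    by rewrite (represents_horner g_iso _ _ AM) Cayley_Hamilton mul0mx.
  rewrite (bimod_horner_eigenvector _ Av) => vq.
  have /cV0Pn[i vi] := v0; apply: (divD_mulf_eq0 divD vi).
  by rewrite -mulmx_scalarE vq mxE.
apply: contrapT => Aa.
have [|c ca cA] := @injective_sylvester_annihilator _ _ _ A a.
  by move=> v Av; apply: contrapT => /eqP v0; case: Aa; exists v.
pose e := vbasis {:D}; pose qs s := map_poly (coord e s) c.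
have qs0 s : horner_alg a (qs s) = 0.
  have := represents_annihilator divD cenD iota_j g_iso AM cA s.
  (* Divisibility over [K] between polynomials coming from [F] already holds over [F], where it can
     be evaluated at [a]. *)
  move=> /char_poly_dvd_exp; rewrite Mq -rmorphXn dvdp_map => /dvdpP[t tq].
  have aqs : horner_alg a (qs s) ^+ N.+1 = 0.
    by rewrite -rmorphXn /= tq rmorphM /= aq mulr0.
  apply: contra_eq aqs => /divD/(unitrX N.+1) U.
  by apply/eqP=> X0; move: U; rewrite X0 unitr0.
(* Splitting the coefficients of [c] along the basis expresses [c(a)] through the values of the
   [qs s], all zero. *)
case/eqP: ca; transitivity (\sum_(s < \dim {:D}) e`_s * horner_alg a (qs s)); last first.
  by rewrite big1 // => s _; rewrite qs0 mulr0.
have ck k : c`_k * a ^+ k = \sum_(s < \dim {:D}) e`_s * ((qs s)`_k *: a ^+ k).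
  rewrite {1}(coord_vbasis_full c`_k) mulr_suml; apply: eq_bigr => s _.
  by rewrite coef_map_id0 ?linear0 // -scalerAl scalerAr.
rewrite horner_coef; under eq_bigr do rewrite ck.
rewrite exchange_big; apply: eq_bigr => s _ /=.
by rewrite (@horner_alg_coef_wide _ _ _ _ (size c)) ?size_poly // mulr_sumr.
Qed.

End Eigenvalues.

Lemma characteristic_polyE (K : fieldType) N (M : 'M[K]_N) :
  characteristic_poly M = (-1) ^+ N *: char_poly M.
Proof.
rewrite /characteristic_poly /char_poly /char_poly_mx -[map_mx _ _ - _]opprB.
by rewrite -scaleN1r detZ -mul_polyC rmorphXn rmorphN1.
Qed.

Theorem theorem2p1 (F : fieldType) (D : falgType F) (d n : nat)
    (hD : central_division_algebra D d) (hn : (0 < n)%N)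
    (K : fieldType) (iota : {rmorphism K -> D}) (hK : maximal_subfield iota)
    (g : 'cV[D]_n -> 'cV[K]_(n * d)) (hg : right_linear_iso iota g)
    (A : 'M[D]_n) (lambda : D)
    (fA : 'M[K]_(n * d)) (hfA : represents g A fA) :
  right_eigenvalue A lambda <->
  eval_in iota (characteristic_poly fA) lambda = 0.
Proof.
have [divD cenD dimD] := hD; have [j jE] := maximal_subfield_base hK.
have d_gt0 : (0 < d)%N.
  rewrite lt0n; apply/eqP=> d0; have := memvf (1 : D).
  by move/eqP: dimD; rewrite d0 dimv_eq0 => /eqP->; rewrite memv0 oner_eq0.
have dimN : (n ^ 2 * \dim {:D} = (n * d) ^ 2)%N by rewrite dimD expnMn.
have := muln_gt0 n d; rewrite hn d_gt0.
(* The size [n * d] is positive, hence of the form [N.+1]. *)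
move: (n * d)%N dimN g hg fA hfA => [|N] // dimN g hg fA hfA _.
have [q qE] := char_poly_base divD cenD jE hg dimN hfA.
rewrite (right_eigenvalue_base_poly divD cenD jE hg _ hfA qE).
rewrite /eval_in characteristic_polyE map_polyZ hornerZ qE -map_poly_comp.
rewrite (eq_map_poly jE) rmorphXn rmorphN1 -[(map_poly _ q).[_]]/(horner_alg lambda q).
(* The two conventions for the characteristic polynomial differ by a sign, which is nonzero in
   [D]. *)
by split=> [aq | /(divD_mulf_eq0 divD) ->]; rewrite ?aq ?mulr0 ?signr_eq0.
Qed.
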